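(* Let $c=\log_2 e$. For integers $n>2k\ge 4$ let $f(n,k)$ denote the maximum of $\min\{|\mathcal A|,|\mathcal B|\}$ over all pairs of families $\mathcal A,\mathcal B\subset\binom{[n]}{k}$ that are disjoint ($\mathcal A\cap\mathcal B=\emptyset$) and cross-intersecting. Then: (i) If $n\ge ck^2+(2-c)k$, then $f(n,k)=\left\lfloor\frac12\binom{n-1}{k-1}\right\rfloor$. (ii) If $n\le ck^2-2ck+1$, then $f(n,k)\neq\left\lfloor\frac12\binom{n-1}{k-1}\right\rfloor$.
   Context: $[n]=\{1,\dots,n\}$ and $\binom{[n]}{k}$ is the collection of all $k$-element subsets of $[n]$. Two families $\mathcal A,\mathcal B$ of sets are cross-intersecting if $A\cap B\neq\emptyset$ for all $A\in\mathcal A$, $B\in\mathcal B$. *)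

(* Defs.v *)
From Stdlib Require Import Reals.
From mathcomp Require Import all_boot.
Set Implicit Arguments. Unset Strict Implicit. Unset Printing Implicit Defensive.

Definition k_uniform (n k : nat) (F : {set {set 'I_n}}) : bool :=
  [forall A in F, #|A| == k].

Definition cross_intersecting (n : nat) (F G : {set {set 'I_n}}) : bool :=
  [forall A in F, forall B in G, A :&: B != set0].

Definition good_pair (n k : nat) (p : {set {set 'I_n}} * {set {set 'I_n}}) : bool :=
  [&& k_uniform k p.1, k_uniform k p.2, [disjoint p.1 & p.2] &
      cross_intersecting p.1 p.2].

Definition fAB (n k : nat) : nat :=
  \max_(p : {set {set 'I_n}} * {set {set 'I_n}} | good_pair k p) minn #|p.1| #|p.2|.

Definition c_log2e : R := Rinv (ln (IZR 2)).

(* Main.v *)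
(** Let C = 'C(n-1, k-1).  In (ii), fix a point x and a (k-1)-set U avoiding x.
    When 2 'C(n-k, k-1) < C, more than half of the k-sets through x meet U, so F
    can be taken among these with C/2 + 1 members, while G consists of the
    remaining k-sets through x together with two k-sets that contain U but not x.

    In (i), if all members of F and G share a point, disjointness gives
    |F| + |G| <= C.  Otherwise apply the shifts i <- j (i < j) to both families.
    - If F has a centre x and G contains a set avoiding x, then
      |F| <= C - 'C(n-k-1, k-1) <= C/2.
    - If a shift creates a common centre, all sets meet a fixed pair {x, y}; the
      Hilton-Milner bound for non-empty cross-intersecting families, applied to
      the sets with trace {x} in one family and {y} in the other, gives
      |F| + |G| <= 2 (C - 'C(n-k-1, k-1) + 1) <= C.
    - If F is shifted, reading sets as lattice walks shows that in one of the
      families at most 'C(n-1, k-2) members avoid the first point.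
      Kruskal-Katona then makes the sets avoiding this point few in both
      families, and the Hilton-Milner type inequality for uniformities k-1 and k
      gives again |F| + |G| <= 2 (C - 'C(n-k-1, k-1) + 1). *)
Require Import Defs.
From Stdlib Require Import Reals Lra.
From mathcomp Require Import all_boot zify.
Set Implicit Arguments. Unset Strict Implicit. Unset Printing Implicit Defensive.

Delimit Scope R_scope with Re.

(** * Families of sets and shifting *)

(** The ground set is a subset [S] of a fixed type, so that inductions can remove a point from it
    without changing types. *)
Definition ksets (T : finType) (S : {set T}) (a : nat) : {set {set T}} :=
  [set A : {set T} | (A \subset S) && (#|A| == a)].

Definition meets (T : finType) (F G : {set {set T}}) :=
  forall A B, A \in F -> B \in G -> exists2 x, x \in A & x \in B.

Definition link (T : finType) (z : T) (F : {set {set T}}) : {set {set T}} :=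
  [set A : {set T} | (z \notin A) && (z |: A \in F)].

Definition del (T : finType) (z : T) (F : {set {set T}}) : {set {set T}} :=
  [set A in F | z \notin A].

Lemma card_ksets (T : finType) (S : {set T}) a : #|ksets S a| = 'C(#|S|, a).
Proof. exact: cards_draws. Qed.

Lemma ksetsP (T : finType) (S : {set T}) a (F : {set {set T}}) (A : {set T}) :
  F \subset ksets S a -> A \in F -> A \subset S /\ #|A| = a.
Proof. by move=> /subsetP sF /sF; rewrite inE => /andP[-> /eqP]. Qed.

Lemma meets_sym (T : finType) (F G : {set {set T}}) : meets F G -> meets G F.
Proof. by move=> h A B hA hB; have [x xB xA] := h B A hB hA; exists x. Qed.

Lemma card_link_del (T : finType) (z : T) (F : {set {set T}}) :
  #|F| = #|link z F| + #|del z F|.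
Proof.
rewrite -(cardsID [set A : {set T} | z \in A] F); congr (_ + _).
  rewrite -(card_in_imset (f := fun A => A :\ z) (D := F :&: _)).
    apply: eq_card => A; rewrite !inE; apply/imsetP/andP.
      by move=> [B]; rewrite !inE => /andP[BF zB] ->; rewrite setD1K // !inE eqxx.
    by case=> zA hA; exists (z |: A); rewrite ?setU1K // !inE eqxx hA.
  move=> A B; rewrite !inE => /andP[_ zA] /andP[_ zB] e.
  by rewrite -(setD1K zA) e setD1K.
by apply: eq_card => A; rewrite !inE andbC.
Qed.

Lemma card_star (T : finType) (S : {set T}) z a :
  z \in S -> #|[set A in ksets S a.+1 | z \in A]| = 'C(#|S|.-1, a).
Proof.
move=> zS.
have -> : 'C(#|S|.-1, a) = #|ksets (S :\ z) a|.
  by rewrite card_ksets (cardsD1 z S) zS.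
rewrite (card_link_del z) [X in _ + X](_ : _ = 0) ?addn0; last first.
  by apply: eq_card0 => A; rewrite !inE; case: (z \in A); rewrite ?andbF.
apply: eq_card => A; rewrite !inE eqxx andbT subsetD1 cardsU1 subUset sub1set zS /=.
by case: (z \in A); rewrite ?andbF ?andbT //= add1n eqSS.
Qed.

Lemma link_sub (T : finType) (S : {set T}) z a (F : {set {set T}}) :
  F \subset ksets S a.+1 -> link z F \subset ksets (S :\ z) a.
Proof.
move=> sF; apply/subsetP => A; rewrite !inE => /andP[zA /(ksetsP sF)[sA cA]].
rewrite subsetD1 zA andbT (subset_trans (subsetUr _ _) sA) /=.
by move/eqP: cA; rewrite cardsU1 zA add1n eqSS.
Qed.

Lemma del_sub (T : finType) (S : {set T}) z a (F : {set {set T}}) :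
  F \subset ksets S a -> del z F \subset ksets (S :\ z) a.
Proof.
move=> sF; apply/subsetP => A; rewrite !inE => /andP[/(ksetsP sF)[sA cA] zA].
by rewrite subsetD1 sA zA cA eqxx.
Qed.

Lemma meets_sub (T : finType) (F F' G G' : {set {set T}}) :
  F' \subset F -> G' \subset G -> meets F G -> meets F' G'.
Proof. by move=> /subsetP sF /subsetP sG h A B /sF hA /sG; apply: h. Qed.

Lemma meets_del (T : finType) z (F G : {set {set T}}) :
  meets F G -> meets (del z F) (del z G).
Proof. by apply: meets_sub; apply/subsetP => A; rewrite inE => /andP[]. Qed.

Lemma meets_link_del (T : finType) z (F G : {set {set T}}) :
  meets F G -> meets (link z F) (del z G).
Proof.
move=> h A B; rewrite !inE => /andP[zA hA] /andP[hB zB].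
have [x] := h _ _ hA hB; rewrite !inE => /orP[/eqP->|xA xB]; last by exists x.
by rewrite (negPf zB).
Qed.

Definition swap (T : finType) (x y : T) (A : {set T}) := x |: (A :\ y).

Definition movable (T : finType) (x y : T) (F : {set {set T}}) (A : {set T}) :=
  [&& y \in A, x \notin A & swap x y A \notin F].

Definition shift_set (T : finType) (x y : T) (F : {set {set T}}) (A : {set T}) :=
  if movable x y F A then swap x y A else A.

Definition shift (T : finType) (x y : T) (F : {set {set T}}) : {set {set T}} :=
  shift_set x y F @: F.

Definition stable (T : finType) (x y : T) (F : {set {set T}}) :=
  forall A, A \in F -> y \in A -> x \notin A -> swap x y A \in F.

Lemma swapK (T : finType) (x y : T) (A : {set T}) :
  y \in A -> x \notin A -> swap y x (swap x y A) = A.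
Proof.
move=> yA xA; rewrite /swap setU1K ?setD1K //.
by rewrite !inE (negPf xA) andbF.
Qed.

Lemma shift_set_inj (T : finType) (x y : T) (F : {set {set T}}) :
  {in F &, injective (shift_set x y F)}.
Proof.
move=> A B hA hB; rewrite /shift_set.
case: ifP => [/and3P[yA xA sA]|_]; case: ifP => [/and3P[yB xB sB]|_] // e.
- by rewrite -(swapK yA xA) e swapK.
- by rewrite e hB in sA.
- by rewrite -e hA in sB.
Qed.

Lemma card_shift (T : finType) (x y : T) (F : {set {set T}}) :
  #|shift x y F| = #|F|.
Proof. exact: card_in_imset (@shift_set_inj _ _ _ _). Qed.

Lemma card_swap (T : finType) (x y : T) (A : {set T}) :
  y \in A -> x \notin A -> #|swap x y A| = #|A|.
Proof.
by move=> yA xA; rewrite cardsU1 !inE (negPf xA) andbF (cardsD1 y A) yA.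
Qed.

Lemma shift_ksets (T : finType) (S : {set T}) a (x y : T) (F : {set {set T}}) :
  x \in S -> F \subset ksets S a -> shift x y F \subset ksets S a.
Proof.
move=> xS sF; apply/subsetP => _ /imsetP[A hA ->].
have [sA cA] := ksetsP sF hA; rewrite /shift_set inE.
case: ifP => [/and3P[yA xA _]|_]; last by rewrite sA cA eqxx.
rewrite card_swap // cA eqxx andbT subUset sub1set xS /=.
exact: subset_trans (subsetDl _ _) sA.
Qed.

(** The critical case is a [B] that contains [y] but not [x]. It stays put because [swap x y B] is
    already in [G]; [A] meets that set in a point other than [x] and [y], which lies in [B] and
    survives the move of [A]. *)
Lemma meets_moved (T : finType) (x y : T) (F G : {set {set T}}) (A B : {set T}) :
  meets F G -> A \in F -> B \in G -> movable x y F A -> ~~ movable x y G B ->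
  exists2 w, w \in swap x y A & w \in B.
Proof.
move=> h hA hB /and3P[yA xA _] nB.
case: (boolP (x \in B)) => xB; first by exists x; rewrite // !inE eqxx.
case: (boolP (y \in B)) => yB; last first.
  have [w wA wB] := h _ _ hA hB; exists w => //.
  by rewrite !inE wA andbT; case: eqP => //= _; apply: contraNneq yB => <-.
have hB' : swap x y B \in G.
  by move: nB; rewrite /movable yB xB /= negbK.
have [w wA] := h _ _ hA hB'; rewrite !inE => /orP[/eqP wx|/andP[wy wB]].
  by rewrite -wx wA in xA.
by exists w; rewrite // !inE wy wA orbT.
Qed.

Lemma meets_shift (T : finType) (x y : T) (F G : {set {set T}}) :
  meets F G -> meets (shift x y F) (shift x y G).
Proof.
move=> h _ _ /imsetP[A hA ->] /imsetP[B hB ->]; rewrite /shift_set.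
case: ifP => mA; case: ifP => mB.
- by exists x; rewrite !inE eqxx.
- by apply: (meets_moved h hA hB mA); rewrite mB.
- have [|w wB wA] := meets_moved (meets_sym h) hB hA mB; first by rewrite mA.
  by exists w.
- exact: h.
Qed.

(** Termination measure for repeated shifting. It is used with the indicator of a point and with the
    index of an ordinal. *)
Definition weight (T : finType) (w : T -> nat) (F : {set {set T}}) :=
  \sum_(A in F) \sum_(i in A) w i.

Lemma weight_swap (T : finType) (w : T -> nat) (x y : T) (A : {set T}) :
  w x < w y -> y \in A -> x \notin A ->
  \sum_(i in swap x y A) w i < \sum_(i in A) w i.
Proof.
move=> wxy yA xA; rewrite big_setU1 ?inE ?(negPf xA) ?andbF //=.
by rewrite [X in _ < X](big_setD1 y) //= ltn_add2r.
Qed.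

Lemma weight_shift (T : finType) (w : T -> nat) (x y : T) (F : {set {set T}}) :
  w x < w y -> weight w (shift x y F) <= weight w F.
Proof.
move=> wxy; rewrite /weight big_imset /=; last exact: shift_set_inj.
apply: leq_sum => A hA; rewrite /shift_set; case: ifP => // /and3P[yA xA _].
by apply: ltnW; apply: weight_swap.
Qed.

Lemma weight_shift_lt (T : finType) (w : T -> nat) (x y : T)
    (F : {set {set T}}) A :
  w x < w y -> A \in F -> movable x y F A ->
  weight w (shift x y F) < weight w F.
Proof.
move=> wxy hA mA; rewrite /weight big_imset /=; last exact: shift_set_inj.
rewrite (big_setD1 A) //= [X in _ < X](big_setD1 A) //=.
rewrite -addSn; apply: leq_add.
  by rewrite /shift_set mA; case/and3P: mA => *; apply: weight_swap.
apply: leq_sum => B hB; rewrite /shift_set; case: ifP => // /and3P[yB xB _].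
by apply: ltnW; apply: weight_swap.
Qed.

(** * The Kruskal-Katona theorem *)

(** Weighted by the indicator of [z], the measure counts incidences with [z], and every shift that
    moves a member of [G] lowers it. Both families are shifted together so that they keep
    meeting. *)
Lemma exists_shifted_away (T : finType) (S : {set T}) (z : T) a b
    (F G : {set {set T}}) :
  F \subset ksets S a -> G \subset ksets S b -> meets F G ->
  exists F' G' : {set {set T}}, [/\ #|F'| = #|F|, #|G'| = #|G|, F' \subset ksets S a,
     G' \subset ksets S b & meets F' G'] /\
     forall y, y \in S -> y != z -> stable y z G'.
Proof.
pose w (i : T) : nat := i == z.
move: {2}_.+1 (ltnSn (weight w F + weight w G)) => N.
elim: N F G => // N IH F G leN sF sG h.
have [/existsP[y /and3P[yS yz /exists_inP[A hA mA]]]|/existsPn nm] :=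
  boolP [exists y, [&& y \in S, y != z & [exists A in G, movable y z G A]]].
  have wyz : w y < w z by rewrite /w eqxx (negPf yz).
  have := weight_shift_lt wyz hA mA; have := weight_shift F wyz => le1 le2.
  have [||||F' [G' [[cF cG sF' sG' h'] st]]] := IH (shift y z F) (shift y z G).
  - lia.
  - exact: shift_ksets.
  - exact: shift_ksets.
  - exact: meets_shift.
  by exists F', G'; split => //; split; rewrite // ?cF ?cG card_shift.
exists F, G; split => // y yS yz A hA zA yA.
have := nm y; rewrite yS yz /= => /exists_inPn /(_ _ hA).
by rewrite /movable zA yA /= negbK.
Qed.

Lemma card_meeting_set (T : finType) (S B : {set T}) a (F : {set {set T}}) :
  F \subset ksets S a -> B \subset S ->
  (forall A, A \in F -> exists2 x, x \in A & x \in B) ->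
  #|F| + 'C(#|S| - #|B|, a) <= 'C(#|S|, a).
Proof.
move=> sF sB h.
have <- : #|ksets (S :\: B) a| = 'C(#|S| - #|B|, a).
  by rewrite card_ksets cardsD (setIidPr sB).
have dis : [disjoint F & ksets (S :\: B) a].
  apply/pred0P => A /=; apply/negP => /andP[/h[x xA xB]].
  by rewrite inE => /andP[/subsetP/(_ _ xA)]; rewrite inE xB.
have := (leq_card_setU F (ksets (S :\: B) a)).2; rewrite dis => /eqP <-.
rewrite -card_ksets.
apply: subset_leq_card; rewrite subUset sF /=; apply/subsetP => A.
by rewrite !inE subsetD => /andP[/andP[-> _] ->].
Qed.

Lemma card_meeting_family (T : finType) (S : {set T}) a b (F G : {set {set T}}) :
  F \subset ksets S a -> G \subset ksets S b -> meets F G -> 0 < #|G| ->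
  #|F| + 'C(#|S| - b, a) <= 'C(#|S|, a).
Proof.
move=> sF sG h /card_gt0P[B hB]; have [sB <-] := ksetsP sG hB.
exact: card_meeting_set sF sB (fun A hA => h A B hA hB).
Qed.

Lemma card_setDl (T : finType) (S : {set T}) (F : {set {set T}}) a :
  F \subset ksets S a -> #|[set S :\: A | A in F]| = #|F|.
Proof.
move=> sF; apply: card_in_imset => A B /(ksetsP sF)[sA _] /(ksetsP sF)[sB _] e.
by rewrite -(setIidPr sA) -(setIidPr sB) -[_ :&: A]set0U -[_ :&: B]set0U
  -(setDv S) -!setDDr e.
Qed.

(** The complement of a member of [G] has size [a] and misses that member, so it is not in [F]. *)
Lemma card_complementary (T : finType) (S : {set T}) a b (F G : {set {set T}}) :
  a + b = #|S| -> F \subset ksets S a -> G \subset ksets S b -> meets F G ->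
  #|F| + #|G| <= 'C(#|S|, a).
Proof.
move=> ab sF sG h; rewrite -(card_setDl sG) -card_ksets.
have dis : [disjoint F & [set S :\: A | A in G]].
  apply/pred0P => A /=; apply/negP => /andP[hA /imsetP[B hB eA]].
  by have [x] := h _ _ hA hB; rewrite eA inE => /andP[/negPf->].
have := (leq_card_setU F [set S :\: A | A in G]).2; rewrite dis => /eqP <-.
apply: subset_leq_card; rewrite subUset sF /=; apply/subsetP => _ /imsetP[B hB ->].
have [sB cB] := ksetsP sG hB.
by rewrite inE subsetDl cardsD (setIidPr sB) cB -ab addnK eqxx.
Qed.

(** Take for [E] all sets of the complementary size that meet every member of [G]. A [b.+1]-set
    whose complement is not in [E] contains some member of [G], hence is that member plus one point.
    Upper bounds on [E] thus become lower bounds on upper shadows. *)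
Lemma card_upper_shadow (T : finType) (S : {set T}) b (G H : {set {set T}}) :
  b < #|S| -> G \subset ksets S b ->
  (forall (D : {set T}) w, D \in G -> w \in S -> w \notin D -> w |: D \in H) ->
  exists E : {set {set T}}, [/\ E \subset ksets S (#|S| - b.+1), meets E G &
    'C(#|S|, b.+1) <= #|E| + #|H|].
Proof.
move=> bS sG up.
pose E := [set E : {set T} in ksets S (#|S| - b.+1) | [forall D in G, E :&: D != set0]].
have sE : E \subset ksets S (#|S| - b.+1).
  by apply/subsetP => A; rewrite inE => /andP[].
exists E; split => //.
  move=> A D; rewrite inE => /andP[_ /forall_inP h] /h /set0Pn[x].
  by rewrite inE => /andP[]; exists x.
rewrite -card_ksets -(card_setDl sE).
apply: leq_trans (leq_card_setU _ _).1; apply: subset_leq_card.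
apply/subsetP => C; rewrite inE => /andP[sC /eqP cC]; rewrite inE.
have CE : S :\: (S :\: C) = C by rewrite setDDr setDv set0U (setIidPr sC).
case: (boolP (S :\: C \in E)) => [hE|].
  by apply/orP; left; apply/imsetP; exists (S :\: C).
rewrite !inE subsetDl cardsD (setIidPr sC) cC eqxx /=.
rewrite negb_forall => /existsP[D]; rewrite negb_imply negbK => /andP[hD /eqP d0].
apply/orP; right; have [sD cD] := ksetsP sG hD.
have DC : D \subset C.
  apply/subsetP => x xD; move/setP/(_ x): d0; rewrite !inE xD (subsetP sD) //= !andbT.
  by move/negbFE.
have /set0Pn[w] : C :\: D != set0.
  by rewrite -card_gt0 cardsD (setIidPr DC) cC cD; lia.
rewrite inE => /andP[wD wC].
have -> : C = w |: D.
  apply/eqP; rewrite eq_sym eqEcard subUset sub1set wC DC cardsU1 wD cC cD /=; lia.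
by apply: up => //; apply: (subsetP sC).
Qed.

Definition cross_bound (T : finType) (m : nat) :=
  forall (S : {set T}) a b j (F G : {set {set T}}),
  #|S| = m -> j <= b -> a + b <= m ->
  F \subset ksets S a -> G \subset ksets S b -> meets F G ->
  'C(m - j, b - j) <= #|G| -> #|F| + 'C(m - j, a) <= 'C(m, a).

(** Replacing [z] by any other point of [S] stays in [G], so the upper shadow of the link lies in
    the deletion. The cross bound on [m] points, applied to the family [E] of [card_upper_shadow],
    makes that shadow large. *)
Lemma shifted_link_del (T : finType) (S : {set T}) z m b j (G : {set {set T}}) :
  cross_bound T m -> z \in S -> #|S| = m.+1 -> j <= b -> b < m ->
  G \subset ksets S b.+1 -> (forall y, y \in S -> y != z -> stable y z G) ->
  'C(m - j, b - j) <= #|link z G| -> 'C(m - j, b.+1 - j) <= #|del z G|.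
Proof.
move=> KK zS cS jb bm sG st hl.
have cS' : #|S :\ z| = m by move: cS; rewrite (cardsD1 z S) zS => -[].
have [|||E [sE mE cE]] := @card_upper_shadow _ (S :\ z) b (link z G) (del z G).
- by rewrite cS'.
- exact: link_sub.
- move=> D w; rewrite !inE => /andP[zD hD] /andP[wz wS] wD.
  rewrite (negPf zD) orbF (eq_sym z) wz andbT.
  have := st w wS wz _ hD; rewrite !inE eqxx /= (negPf wz) (negPf wD) => /(_ isT isT).
  by rewrite /swap setU1K.
move: sE cE; rewrite cS' => sE cE.
have ab : m - b.+1 + b <= m by lia.
have := KK _ _ _ j _ _ cS' jb ab sE (link_sub z sG) mE hl.
rewrite (bin_sub bm) (_ : m - b.+1 = m - j - (b.+1 - j)); last by lia.
by rewrite bin_sub; lia.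
Qed.

(** If members [A] and [B] of the links were disjoint, the size condition would leave a point [w] of
    [S] outside both and different from [z]. By stability [w |: B] is in [G], yet it misses
    [z |: A]. *)
Lemma meets_link_shifted (T : finType) (S : {set T}) z a b (F G : {set {set T}}) :
  z \in S -> a.+1 + b.+1 <= #|S| ->
  F \subset ksets S a.+1 -> G \subset ksets S b.+1 -> meets F G ->
  (forall y, y \in S -> y != z -> stable y z G) -> meets (link z F) (link z G).
Proof.
move=> zS ab sF sG h st A B hA hB.
have [/set0Pn[x]|/negPn/eqP d0] := boolP (A :&: B != set0).
  by rewrite inE => /andP[]; exists x.
have [sA cA] := ksetsP (link_sub z sF) hA.
have [sB cB] := ksetsP (link_sub z sG) hB.
have /set0Pn[w] : (S :\ z) :\: (A :|: B) != set0.
  rewrite -card_gt0 cardsD (setIidPr _) ?subUset ?sA //.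
  have := cardsUI A B; rewrite d0 cards0 cA cB; have := cardsD1 z S; rewrite zS; lia.
rewrite !inE negb_or => /and3P[/andP[wA wB] wz wS].
move: hA hB; rewrite !inE => /andP[zA hA] /andP[zB hB].
have := st w wS wz _ hB; rewrite !inE eqxx /= (negPf wz) (negPf wB) => /(_ isT isT).
rewrite /swap setU1K // => hB'.
have [x] := h _ _ hA hB'; rewrite !inE.
move=> /orP[/eqP->|xA]; first by rewrite (negPf zB) orbF eq_sym (negPf wz).
by move=> /orP[/eqP e|xB]; [rewrite -e xA in wA | exists x].
Qed.

(* The integral form of Lovasz's version of the Kruskal-Katona theorem, stated
   for cross-intersecting families: the complements of the members of G span at
   least 'C(m - j, a) a-sets, none of which is in F. *)
Theorem kruskal_katona (T : finType) m : cross_bound T m.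
Proof.
elim: m => [|m IH] S a b j F G cS jb ab sF sG h hG.
  have G0 : 0 < #|G| by apply: leq_trans hG; rewrite bin_gt0; lia.
  by have := card_meeting_family sF sG h G0; rewrite cS (_ : b = j) //; lia.
have G0 : 0 < #|G| by apply: leq_trans hG; rewrite bin_gt0; lia.
have := card_meeting_family sF sG h G0; rewrite cS => hb.
move: jb; rewrite leq_eqVlt => /orP[/eqP-> //|jb].
case: a ab sF hb => [|a] ab sF hb; first by rewrite bin0 in hb *; rewrite bin0.
case: b ab jb sG hG hb => // b ab jb sG hG hb.
(* With complementary uniformities the deletions would be too large for the induction hypothesis on
   [m] points. *)
have [e|ne] := eqVneq (a.+1 + b.+1) m.+1.
  have e' : a.+1 + b.+1 = #|S| by rewrite cS.
  have := card_complementary e' sF sG h; rewrite cS => le1.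
  have : 'C(m.+1 - j, b.+1 - j) = 'C(m.+1 - j, a.+1); last by lia.
  by rewrite -bin_sub; [congr 'C(_, _); lia | lia].
have [z zS] : exists z, z \in S by apply/set0Pn; rewrite -card_gt0 cS.
have [F' [G' [[<- cG' sF' sG' h'] st]]] := exists_shifted_away z sF sG h.
have cS' : #|S :\ z| = m by move: cS; rewrite (cardsD1 z S) zS => -[].
(* By Pascal's rule either the deletion is this large already, or the link has at least
   ['C(m - j, b - j)] members and stability enlarges the deletion. The deletion of [G'] then bounds
   both parts of [F']. *)
have hdel : 'C(m - j, b.+1 - j) <= #|del z G'|.
  case: leqP => // lt; suff : 'C(m - j, b.+1 - j) <= #|del z G'| by rewrite leqNgt lt.
  apply: (shifted_link_del IH zS cS _ _ sG' st); try lia.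
  move: hG; rewrite -cG' (card_link_del z G') (subSn (n := m)) //; last by lia.
  by rewrite (subSn (n := b)) // in lt *; rewrite binS; lia.
have ab1 : a.+1 + b.+1 <= m by lia.
have ab2 : a + b.+1 <= m by lia.
have := IH _ _ _ j _ _ cS' (ltnW jb) ab1 (del_sub z sF') (del_sub z sG')
  (@meets_del _ z _ _ h') hdel.
have := IH _ _ _ j _ _ cS' (ltnW jb) ab2 (link_sub z sF') (del_sub z sG')
  (@meets_link_del _ z _ _ h') hdel.
rewrite (card_link_del z F') (subSn (n := m)); last by lia.
by rewrite !binS; lia.
Qed.

(** Double induction by Pascal's rule, starting from the boundary [h = a.+1], where equality holds.
    Adding the two induction hypotheses costs an extra 1, which the positive term ['C(h, a)]
    absorbs. *)
Lemma bin_ballot h a : a < h ->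
  'C(h + a, a) + 'C(h, a.+1) <= 'C(h + a, a.+1) + 1.
Proof.
elim: a h => [|a IHa] h; first by rewrite addn0 !bin0 bin1 addnC.
elim: h => // h IHh; rewrite leq_eqVlt => /orP[/eqP[<-]|ah].
  rewrite binn leq_add2r -bin_sub; last by lia.
  by rewrite leq_eqVlt; apply/orP; left; apply/eqP; congr 'C(_, _); lia.
have := IHh ah; have := IHa h.+1 (ltnW (ltnW ah)).
rewrite !addSn !addnS !binS; have : 0 < 'C(h, a) by rewrite bin_gt0; lia.
by lia.
Qed.

(** * Sums of sizes of cross-intersecting families *)

(* Equality holds when |G| = 1.  The upper bound on |G| is needed for j > 1: the
   families of all sets through a fixed point can violate the inequality. *)
Theorem cross_intersecting_sum (T : finType) m (S : {set T}) a j
    (F G : {set {set T}}) :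
  #|S| = m -> 0 < j -> a.+1 + (a + j) <= m ->
  F \subset ksets S a.+1 -> G \subset ksets S (a + j) -> meets F G ->
  0 < #|G| <= 'C(m - j, a) ->
  #|F| + #|G| + 'C(m - (a + j), a.+1) <= 'C(m, a.+1) + 1.
Proof.
elim: m S a F G => [//|m IH] S [|a] F G cS j0 ab sF sG h /andP[G0 leG].
  have := card_meeting_family sF sG h G0; move: leG; rewrite bin0 cS; lia.
rewrite !(addSn a j) in ab sG *.
have [e|ne] := eqVneq (a.+2 + (a + j).+1) m.+1.
  have e' : a.+2 + (a + j).+1 = #|S| by rewrite cS.
  have := card_complementary e' sF sG h; rewrite cS => le1.
  by rewrite (_ : m.+1 - (a + j).+1 = a.+2) ?binn; lia.
have [z zS] : exists z, z \in S by apply/set0Pn; rewrite -card_gt0 cS.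
have [F' [G' [[cF' cG' sF' sG' h'] st]]] := exists_shifted_away z sF sG h.
rewrite -cF' -cG' in G0 leG *.
have cS' : #|S :\ z| = m by move: cS; rewrite (cardsD1 z S) zS => -[].
have lbm : a + j < m by lia.
have link_del i (ib : i <= a + j) := @shifted_link_del _ S z m (a + j) i G'
  (@kruskal_katona T m) zS cS ib lbm sG' st.
(* One member of the link suffices: [link_del] with its index equal to the uniformity [a + j] of the
   link turns it into members of the deletion. *)
have d0 : 0 < #|del z G'|.
  have [l0|l0] := posnP #|link z G'|.
    by move: G0; rewrite (card_link_del z) l0.
  have := link_del (a + j) (leqnn _); rewrite subnn bin0 subSnn bin1 => /(_ l0); lia.
have mdl := @meets_link_del _ z _ _ h'; have mdd := @meets_del _ z _ _ h'.
have mj : m.+1 - j = (m - j).+1 by lia.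
have mb : m.+1 - (a + j).+1 = (m - (a + j).+1).+1 by lia.
(* For a large deletion, Kruskal-Katona leaves [F'] a deficit of ['C(m.+1 - j, a.+2)], and
   [bin_ballot] shows that this pays for the largest size allowed to [G']. Otherwise the induction
   hypothesis applies to links and deletions separately. *)
have [led|ltd] := leqP 'C(m - j, a.+1) #|del z G'|.
  have jb : j <= (a + j).+1 by lia.
  have ab1 : a.+2 + (a + j).+1 <= m by lia.
  have ab2 : a.+1 + (a + j).+1 <= m by lia.
  rewrite (_ : a.+1 = (a + j).+1 - j) in led; last by lia.
  have := kruskal_katona cS' jb ab1 (del_sub z sF') (del_sub z sG') mdd led.
  have := kruskal_katona cS' jb ab2 (link_sub z sF') (del_sub z sG') mdl led.
  have := @bin_ballot (m.+1 - (a + j).+1) a.+1 ltac:(lia).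
  rewrite (_ : m.+1 - (a + j).+1 + a.+1 = m.+1 - j); last by lia.
  rewrite (card_link_del z F') => hb h1 h2; move: leG.
  have : 'C(m.+1 - j, a.+2) = 'C(m - j, a.+2) + 'C(m - j, a.+1) by rewrite mj binS.
  rewrite [in X in _ -> _ -> _ <= X]binS; lia.
(* A larger link would, by stability, force the deletion over the threshold just excluded. *)
have ltl : #|link z G'| < 'C(m - j, a).
  rewrite ltnNge; apply/negP => lel; have := link_del j (leq_addl _ _).
  rewrite addnK subSn ?leq_addl // addnK => /(_ lel); lia.
have := IH (S :\ z) a.+1 (del z F') (del z G') cS' j0.
rewrite (addSn a j) d0 (ltnW ltd) => /(_ _ _ _ mdd isT) hd.
have {}hd := hd ltac:(lia) (del_sub z sF') (del_sub z sG').
rewrite (card_link_del z F') (card_link_del z G') mb !binS.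
have [l0|l0] := posnP #|link z G'|.
  have := card_meeting_family (link_sub z sF') (del_sub z sG') mdl d0.
  rewrite cS'; lia.
have mll : meets (link z F') (link z G').
  by apply: (meets_link_shifted zS _ sF' sG' h' st); rewrite cS; lia.
have := IH (S :\ z) a (link z F') (link z G') cS' j0 ltac:(lia)
  (link_sub z sF') (link_sub z sG') mll.
rewrite l0 (ltnW ltl) => /(_ isT).
rewrite (_ : m - (a + j) = (m - (a + j).+1).+1) ?binS; last by lia.
(* The two induction bounds together allow an excess of 2 instead of 1; this surplus term absorbs
   the difference. *)
have : 0 < 'C(m - (a + j).+1, a) by rewrite bin_gt0; lia.
lia.
Qed.

Lemma cross_intersecting_sum_uniform (T : finType) (S : {set T}) a
    (F G : {set {set T}}) :
  a.+1 + a.+1 <= #|S| ->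
  F \subset ksets S a.+1 -> G \subset ksets S a.+1 -> meets F G ->
  0 < #|F| -> 0 < #|G| ->
  #|F| + #|G| + 'C(#|S| - a.+1, a.+1) <= 'C(#|S|, a.+1) + 1.
Proof.
move=> ab sF sG h F0 G0.
have sum F1 G1 := @cross_intersecting_sum _ _ S a 1 F1 G1 erefl isT.
rewrite addn1 in sum.
have [leG|ltG] := leqP #|G| 'C(#|S| - 1, a); first by apply: sum; rewrite ?G0.
suff leF : #|F| <= 'C(#|S| - 1, a).
  by rewrite (addnC #|F|); apply: sum; rewrite ?F0 //; apply: meets_sym.
have := @kruskal_katona _ _ S a.+1 a.+1 1 F G erefl isT ab sF sG h.
rewrite (_ : a.+1 - 1 = a) ?subn1 // in ltG * => /(_ (ltnW ltG)).
by case: #|S| ab => // s _; rewrite binS /=; lia.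
Qed.

(** * Shifted families and lattice walks *)

Definition prefix_set n (A : {set 'I_n}) (j : nat) : {set 'I_n} :=
  [set i in A | i < j].

Definition shifted n (F : {set {set 'I_n}}) :=
  forall i j : 'I_n, i < j -> stable i j F.

Lemma card_ord_lt n j : j <= n -> #|[set i : 'I_n | i < j]| = j.
Proof.
move=> le_jn; rewrite -sum1_card.
transitivity (\sum_(i < n | i < j) 1); first by apply: eq_bigl => i; rewrite inE.
by rewrite -(big_ord_widen n (fun=> 1) le_jn) sum_nat_const card_ord muln1.
Qed.

Lemma prefix_setD1 n (A : {set 'I_n}) (x : 'I_n) j : x \in A -> x < j ->
  #|prefix_set A j| = (#|prefix_set (A :\ x) j|).+1.
Proof.
move=> xA xj; rewrite (cardsD1 x (prefix_set A j)) !inE xA xj /= add1n.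
by congr _.+1; apply: eq_card => i; rewrite !inE andbA.
Qed.

Lemma card_prefix_set n (A B : {set 'I_n}) j : j <= n ->
  #|prefix_set A j| + #|prefix_set B j| + #|prefix_set (~: (A :|: B)) j|
  = j + #|prefix_set (A :&: B) j|.
Proof.
move=> le_jn; rewrite -cardsUI.
have -> : prefix_set A j :&: prefix_set B j = prefix_set (A :&: B) j.
  by apply/setP => i; rewrite !inE; case: (i < j); rewrite ?andbT ?andbF.
have -> : prefix_set A j :|: prefix_set B j = prefix_set (A :|: B) j.
  by apply/setP => i; rewrite !inE -andb_orl.
have := cardsID (A :|: B) [set i : 'I_n | i < j]; rewrite card_ord_lt // => {4}<-.
by rewrite addnAC; congr (_ + _ + _); apply: eq_card => i; rewrite !inE andbC.
Qed.

(* If every prefix had at most as many common elements as holes (elements outside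
   both sets), the common elements could be shifted one by one into holes. *)
Lemma shifted_not_balanced n (F G : {set {set 'I_n}}) (A B : {set 'I_n}) :
  shifted F -> meets F G -> A \in F -> B \in G ->
  ~ (forall j, j <= n ->
     #|prefix_set (A :&: B) j| <= #|prefix_set (~: (A :|: B)) j|).
Proof.
move=> shF h hA hB; move: {2}#|_| (erefl #|A :&: B|) => s.
elim: s A hA => [|s IH] A hA cAB bal.
  have [x xA xB] := h _ _ hA hB.
  by move/eqP: cAB; rewrite cards_eq0 => /eqP/setP/(_ x); rewrite !inE xA xB.
have [x0 hx0] : exists x, x \in A :&: B by apply/card_gt0P; rewrite cAB.
case: (arg_minnP (fun i : 'I_n => nat_of_ord i) hx0) => x xAB0 xmin.
(* [x] is the first common element, so the prefix ending at [x] contains a hole [z]; moving [x] to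
   [z] in [A] removes one common element and one hole. *)
have {xAB0} xAB : x \in A :&: B := xAB0.
have := bal x.+1 (ltn_ord x); rewrite (prefix_setD1 xAB) // => c0.
have /card_gt0P[z] : 0 < #|prefix_set (~: (A :|: B)) x.+1| by lia.
rewrite !inE negb_or ltnS => /andP[/andP[zA zB] zx].
have /setIP[xA xB] : x \in A :&: B := xAB.
have ltzx : z < x.
  by rewrite ltn_neqAle zx andbT; apply: contraNneq zA => /ord_inj ->.
have nzx : z != x by apply: contraNneq zA => ->.
have EI : swap z x A :&: B = (A :&: B) :\ x.
  apply/setP => i; rewrite !inE andbA; case: (eqVneq i z) => [->|//] /=.
  by rewrite (negPf zA) (negPf zB) andbF.
have EU : ~: (swap z x A :|: B) = (~: (A :|: B)) :\ z.
  apply/setP => i; rewrite !inE; case: (eqVneq i z) => //= _.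
  by case: (eqVneq i x) => [->|//] /=; rewrite xA xB.
apply: (IH (swap z x A)) => [||j le_jn].
- exact: shF.
- by rewrite EI; move: cAB; rewrite (cardsD1 x) xAB => -[].
(* Prefixes not containing [x] have no common element by minimality; in those containing [x], both
   counts drop by one. *)
rewrite EI EU; have [lejx|ltxj] := leqP j x.
  rewrite (_ : #|_| = 0) //; apply: eq_card0 => i; rewrite !inE.
  apply/negP => /andP[/andP[_ iAB] ij].
  have iI : i \in A :&: B by rewrite inE.
  by have := xmin i iI; lia.
have zU : z \in ~: (A :|: B) by rewrite !inE negb_or zA zB.
have := bal j le_jn.
by rewrite (prefix_setD1 xAB) // (prefix_setD1 zU) // (ltn_trans ltzx).
Qed.

(** Read [A] as a walk going up at its elements and down elsewhere: the condition says that the walk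
    rises above its starting height. *)
Definition leads n (A : {set 'I_n}) :=
  [exists j : 'I_n.+1, j < 2 * #|prefix_set A j|].

(** If neither [A] nor [B] leads, each fills at most half of every prefix. Inclusion-exclusion then
    gives every prefix at least as many holes as common elements, which [shifted_not_balanced]
    forbids. *)
Lemma shifted_leads n (F G : {set {set 'I_n}}) :
  shifted F -> meets F G ->
  {in F, forall A, leads A} \/ {in G, forall B, leads B}.
Proof.
move=> shF h.
have [/forall_inP|/forall_inPn[A hA nA]] := boolP [forall A in F, leads A].
  by left.
right=> B hB; apply: contraT => nB; exfalso.
apply: (shifted_not_balanced shF h hA hB) => j le_jn.
have jn : j < n.+1 by [].
move/existsPn/(_ (Ordinal jn)): nA; move/existsPn/(_ (Ordinal jn)): nB => /=.
have := card_prefix_set A B le_jn.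
set a := #|prefix_set A j|; set b := #|prefix_set B j|.
set c := #|prefix_set (A :&: B) j|; set d := #|prefix_set (~: _) j|; lia.
Qed.

(** * Counting lattice walks that reach a given height *)

Fixpoint words n k : seq (seq bool) :=
  if n is n'.+1 then
    map (cons false) (words n' k) ++
    (if k is k'.+1 then map (cons true) (words n' k') else [::])
  else if k is 0 then [:: [::]] else [::].

Lemma size_words n k : size (words n k) = 'C(n, k).
Proof.
elim: n k => [|n IH] [|k] //=; rewrite size_cat !size_map !IH //.
by rewrite !bin0.
Qed.

Lemma mem_words (s : seq bool) : s \in words (size s) (count id s).
Proof.
elim: s => [|[] s IH] //=; rewrite mem_cat ?add1n ?add0n.
  by apply/orP; right; apply: map_f.
by apply/orP; left; apply: map_f.
Qed.

(** The walk of [s], going up at [true] and down at [false], reaches height at least [t]. *)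
Definition hits t (s : seq bool) :=
  has (fun j => j + t <= 2 * count id (take j s)) (iota 0 (size s).+1).

Lemma hitsP t (s : seq bool) :
  reflect (exists2 j, j <= size s & j + t <= 2 * count id (take j s)) (hits t s).
Proof.
apply: (iffP hasP) => -[j]; rewrite ?mem_iota => le1 le2; exists j => //.
by rewrite mem_iota.
Qed.

Lemma hits_false t s : hits t.+1 (false :: s) -> hits t.+2 s.
Proof.
move=> /hitsP[[|j]] /= le1 le2; first by lia.
by apply/hitsP; exists j => //; lia.
Qed.

Lemma hits_true t s : hits t.+1 (true :: s) -> hits t s.
Proof.
move=> /hitsP[[|j]] /= le1 le2; first by lia.
by apply/hitsP; exists j => //; lia.
Qed.

(** The bound given by the reflection principle, obtained by recursion on the first letter: it
    changes the height still to be climbed by one, and the two cases add up by Pascal's rule. *)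
Lemma count_hits t n k :
  count (hits t) (words n k) <= if t <= k then 'C(n, k - t) else 0.
Proof.
elim: n t k => [|n IH] [|t] k.
- by rewrite leq0n subn0 -size_words count_size.
- by case: k.
- by rewrite leq0n subn0 -size_words count_size.
rewrite /= count_cat count_map.
have le1 : count (preim (cons false) (hits t.+1)) (words n k)
    <= if t.+2 <= k then 'C(n, k - t.+2) else 0.
  by apply: leq_trans (IH _ _); apply: sub_count => s; apply: hits_false.
case: k le1 => [|k] le1; first by rewrite addn0.
have le2 : count (hits t.+1) (map (cons true) (words n k))
    <= if t <= k then 'C(n, k - t) else 0.
  rewrite count_map; apply: leq_trans (IH _ _).
  by apply: sub_count => s; apply: hits_true.
apply: leq_trans (leq_add le1 le2) _; rewrite !subSS !ltnS.
case: (leqP t k) => le_tk; last by rewrite ltnNge (ltnW le_tk).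
case: (ltnP t k) => ltk; last first.
  have -> : k = t by lia.
  by rewrite subnn !bin0.
by rewrite (_ : k - t = (k - t.+1).+1) ?binS; lia.
Qed.

Definition word n (A : {set 'I_n}) : seq bool := [seq i \in A | i <- enum 'I_n].

Lemma size_word n (A : {set 'I_n}) : size (word A) = n.
Proof. by rewrite size_map size_enum_ord. Qed.

Lemma word_inj n : injective (@word n).
Proof.
move=> A B e; apply/setP => i.
by move/eq_in_map: e => /(_ i); rewrite mem_enum => /(_ isT).
Qed.

Lemma take_enum_ord n j : take j (enum 'I_n) = [seq i <- enum 'I_n | val i < j].
Proof.
apply: (inj_map val_inj); rewrite map_take val_enum_ord.
rewrite -(filter_map val (fun i => i < j)) val_enum_ord.
rewrite take_iota; have [le_jn|/ltnW le_nj] := leqP j n.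
  rewrite -{1}(subnKC le_jn) iotaD filter_cat (all_filterP _); last first.
    by apply/allP => i; rewrite mem_iota; lia.
  rewrite (eq_in_filter (a2 := pred0)) ?filter_pred0 ?cats0 // => i.
  by rewrite mem_iota /= => h; apply/negP; lia.
rewrite (all_filterP _) //.
by apply/allP => i; rewrite mem_iota; lia.
Qed.

Lemma count_take_word n (A : {set 'I_n}) j :
  count id (take j (word A)) = #|prefix_set A j|.
Proof.
rewrite -map_take count_map take_enum_ord count_filter -sum1_count -sum1_card.
by rewrite big_enum_cond /=; apply: eq_bigl => i; rewrite !inE.
Qed.

Lemma count_word n (A : {set 'I_n}) : count id (word A) = #|A|.
Proof.
rewrite -[word A]take_size count_take_word size_word.
by apply: eq_card => i; rewrite !inE ltn_ord andbT.
Qed.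

(** Missing the first point means a first step down, so the remaining walk of length [n] must climb
    to height 2. *)
Lemma card_leads n k (F : {set {set 'I_n.+1}}) : 1 < k ->
  (forall A, A \in F -> [/\ #|A| = k, ord0 \notin A & leads A]) ->
  #|F| <= 'C(n, k - 2).
Proof.
move=> k2 hF.
have wordE A : A \in F -> word A = false :: behead (word A).
  by move=> /hF[_ /negPf A0 _]; rewrite /word enum_ordSl /= A0.
have := count_hits 2 n k; rewrite k2; apply: leq_trans.
rewrite -size_filter cardE -(size_map (fun A => behead (word A))).
apply: uniq_leq_size.
  rewrite map_inj_in_uniq ?enum_uniq // => A B; rewrite !mem_enum => hA hB e.
  by apply: word_inj; rewrite wordE // e -wordE.
move=> s /mapP[A]; rewrite mem_enum => hA ->; have [cA _ /existsP[j lj]] := hF A hA.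
have sz : size (behead (word A)) = n by rewrite size_behead size_word.
have ct : count id (behead (word A)) = k by rewrite -cA -count_word [in RHS]wordE.
have := mem_words (behead (word A)); rewrite sz ct mem_filter => ->; rewrite andbT.
apply: hits_false; rewrite -wordE //; apply/hitsP; exists j.
  by rewrite size_word -ltnS.
by rewrite count_take_word addn1.
Qed.

(** * Families without a common centre *)

Definition centered (T : finType) (x : T) (F : {set {set T}}) :=
  [forall A in F, x \in A].

Lemma centeredP (T : finType) (x : T) (F : {set {set T}}) :
  reflect (forall A, A \in F -> x \in A) (centered x F).
Proof. exact: forall_inP. Qed.

Lemma centeredPn (T : finType) (x : T) (F : {set {set T}}) :
  reflect (exists2 A, A \in F & x \notin A) (~~ centered x F).
Proof. exact: forall_inPn. Qed.

Lemma del_gt0 (T : finType) (x : T) (F : {set {set T}}) :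
  ~~ centered x F -> 0 < #|del x F|.
Proof.
by move=> /centeredPn[A hA xA]; apply/card_gt0P; exists A; rewrite inE hA.
Qed.

Lemma card_setTD1 N (x : 'I_N.+1) : #|[set: 'I_N.+1] :\ x| = N.
Proof. by have := cardsD1 x [set: 'I_N.+1]; rewrite cardsT card_ord inE => -[]. Qed.

Lemma bin_pred n m : 0 < n -> 'C(n, m.+1) = 'C(n.-1, m.+1) + 'C(n.-1, m).
Proof. by case: n. Qed.

Lemma centered_bound N a (x : 'I_N.+1) (F G : {set {set 'I_N.+1}}) :
  F \subset ksets setT a.+2 -> G \subset ksets setT a.+2 -> meets F G ->
  centered x F -> ~~ centered x G ->
  #|F| + 'C(N - a.+2, a.+1) <= 'C(N, a.+1).
Proof.
move=> sF sG h /centeredP cF nG.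
have := card_meeting_family (link_sub x sF) (del_sub x sG)
  (@meets_link_del _ x _ _ h) (del_gt0 nG).
rewrite card_setTD1 (card_link_del x F) (_ : #|del x F| = 0) ?addn0 //.
by apply: eq_card0 => A; rewrite !inE; apply/negP => /andP[/cF ->].
Qed.

(** Split each family by its trace on [{x, y}]. Sets with trace [{x}] in one family and [{y}] in the
    other can only meet outside the pair, so [half] applies the uniform sum bound to both such
    pairings; sets containing both points number at most ['C(N.-1, a)] per family. *)
Lemma two_point_bound N a (x y : 'I_N.+1) (F G : {set {set 'I_N.+1}}) :
  2 * a.+2 <= N -> x != y ->
  F \subset ksets setT a.+2 -> G \subset ksets setT a.+2 -> meets F G ->
  (forall A, A \in F :|: G -> (x \in A) || (y \in A)) ->
  ~~ centered x F -> ~~ centered x G -> ~~ centered y F -> ~~ centered y G ->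
  #|F| + #|G| + 2 * 'C(N - a.+2, a.+1) <= 2 * 'C(N, a.+1) + 2.
Proof.
move=> hN xy sF sG h hxy xF xG yF yG.
pose S := [set: 'I_N.+1] :\ x :\ y.
have cS : #|S| = N.-1.
  have yS : y \in [set: 'I_N.+1] :\ x by rewrite !inE eq_sym xy.
  by have := cardsD1 y ([set: 'I_N.+1] :\ x); rewrite yS card_setTD1 => /(congr1 predn)/esym.
have half (H K : {set {set 'I_N.+1}}) : H \subset ksets setT a.+2 ->
    K \subset ksets setT a.+2 -> meets H K ->
    (forall A, A \in H :|: K -> (x \in A) || (y \in A)) ->
    ~~ centered y H -> ~~ centered x K ->
    #|del y (link x H)| + #|link y (del x K)| + 'C(N - a.+2, a.+1)
    <= 'C(N.-1, a.+1) + 1.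
  move=> sH sK hHK hm /centeredPn[A hA yA] /centeredPn[B hB xB].
  have -> : N - a.+2 = #|S| - a.+1 by rewrite cS; move: hN; clear; lia.
  rewrite -cS; apply: cross_intersecting_sum_uniform.
  - by rewrite cS; move: hN; clear; lia.
  - exact: del_sub (link_sub x sH).
  - exact: link_sub (del_sub x sK).
  - exact: meets_sym (meets_link_del (meets_sym (meets_link_del hHK))).
  - apply/card_gt0P; exists (A :\ x).
    have xA : x \in A by have := hm A; rewrite inE hA (negPf yA) orbF => /(_ isT).
    by rewrite !inE eqxx setD1K // hA (negPf yA) andbF.
  - apply/card_gt0P; exists (B :\ y).
    have yB : y \in B by have := hm B; rewrite inE hB (negPf xB) orbT => /(_ isT).
    rewrite inE; apply/andP; split; first by rewrite !inE eqxx.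
    by rewrite setD1K // inE hB.
have card (H : {set {set 'I_N.+1}}) : H \subset ksets setT a.+2 ->
    (forall A, A \in H -> (x \in A) || (y \in A)) ->
    #|H| <= 'C(N.-1, a) + #|del y (link x H)| + #|link y (del x H)|.
  move=> sH hm; rewrite (card_link_del x H) (card_link_del y (link x H)).
  rewrite (card_link_del y (del x H)) (_ : #|del y (del x H)| = 0) ?addn0.
    rewrite !leq_add2r -cS -card_ksets; apply: subset_leq_card.
    exact: link_sub (link_sub x sH).
  apply: eq_card0 => A; rewrite !inE; apply/negP => /andP[/andP[/hm]].
  by case: (x \in A) => //= ->.
have := half F G sF sG h hxy yF xG.
have hxy' : forall A, A \in G :|: F -> (x \in A) || (y \in A).
  by move=> A; rewrite setUC; apply: hxy.
have := half G F sG sF (meets_sym h) hxy' yG xF.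
have hxyF : forall A, A \in F -> (x \in A) || (y \in A).
  by move=> A hA; apply: hxy; rewrite inE hA.
have hxyG : forall A, A \in G -> (x \in A) || (y \in A).
  by move=> A hA; apply: hxy; rewrite inE hA orbT.
have := card F sF hxyF; have := card G sG hxyG.
have := @bin_pred N a (leq_trans (isT : 0 < 2 * a.+2) hN).
lia.
Qed.

(** If one deletion exceeds ['C(N - 2, a)], Kruskal-Katona with [j = 2] leaves the link of the other
    family at most [2 * 'C(N, a)] members; its own deletion adds at most ['C(N, a)], whence the
    factor 6 in the hypothesis. If both deletions are small, the sum inequality with [j = 2] is
    applied to each link paired with the opposite deletion. *)
Lemma popular_point_bound (T : finType) (S : {set T}) z N a (F G : {set {set T}}) :
  2 * a.+2 <= N -> 'C(N, a.+1) + 2 <= 2 * 'C(N - a.+2, a.+1) ->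
  6 * 'C(N, a) <= 'C(N, a.+1) -> #|S :\ z| = N ->
  F \subset ksets S a.+2 -> G \subset ksets S a.+2 -> meets F G ->
  0 < #|del z F| <= 'C(N, a) -> 0 < #|del z G| ->
  2 * #|F| <= 'C(N, a.+1) \/ 2 * #|G| <= 'C(N, a.+1).
Proof.
move=> hN num1 num2 cS sF sG h /andP[F0 dF] G0.
have ab : a.+1 + a.+2 <= N by lia.
have binD : 'C(N, a.+1) <= 'C(N - 2, a.+1) + 2 * 'C(N, a) /\ 'C(N - 2, a) <= 'C(N, a).
  have [M ->] : exists M, N = M.+2 by exists N.-2; lia.
  rewrite subn2 /= 2!binS; have : 'C(M.+1, a) <= 'C(M.+2, a) by apply: leq_bin2l; lia.
  have : 'C(M, a) <= 'C(M.+2, a) by apply: leq_bin2l; lia.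
  by lia.
have kk (H K : {set {set T}}) (sH : H \subset ksets S a.+2)
    (sK : K \subset ksets S a.+2) (hHK : meets H K) :=
  @kruskal_katona _ _ _ a.+1 a.+2 2 _ _ cS isT ab
    (link_sub z sH) (del_sub z sK) (@meets_link_del _ z H K hHK).
rewrite (_ : a.+2 - 2 = a) in kk; last by rewrite subn2.
have [leG|/ltnW ltG] := leqP #|del z G| 'C(N - 2, a); last first.
  by left; have := kk F G sF sG h ltG; rewrite (card_link_del z F); lia.
have [leF|/ltnW ltF] := leqP #|del z F| 'C(N - 2, a); last first.
  by right; have := kk G F sG sF (meets_sym h) ltF; rewrite (card_link_del z G); lia.
have sum (H K : {set {set T}}) :=
  @cross_intersecting_sum _ _ _ a 2 (link z H) (del z K) cS isT.
rewrite addn2 in sum.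
have := sum F G ab (link_sub z sF) (del_sub z sG) (meets_link_del h).
have := sum G F ab (link_sub z sG) (del_sub z sF) (meets_link_del (meets_sym h)).
rewrite G0 leG F0 leF => /(_ isT) + /(_ isT).
have := card_link_del z F; have := card_link_del z G; lia.
Qed.

Lemma leads_bound N a (F G : {set {set 'I_N.+1}}) :
  2 * a.+2 <= N -> 'C(N, a.+1) + 2 <= 2 * 'C(N - a.+2, a.+1) ->
  6 * 'C(N, a) <= 'C(N, a.+1) ->
  F \subset ksets setT a.+2 -> G \subset ksets setT a.+2 -> meets F G ->
  {in F, forall A, leads A} ->
  ~~ centered ord0 F -> ~~ centered ord0 G ->
  2 * #|F| <= 'C(N, a.+1) \/ 2 * #|G| <= 'C(N, a.+1).
Proof.
move=> hN num1 num2 sF sG h ld nF nG.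
apply: (popular_point_bound hN num1 num2 (card_setTD1 ord0) sF sG h);
  rewrite ?del_gt0 //=.
have := @card_leads N a.+2 (del ord0 F) isT; rewrite subn2; apply => A.
rewrite inE => /andP[hA A0].
by have [_ cA] := ksetsP sF hA; split=> //; apply: ld.
Qed.

Theorem no_common_center_bound N a (F G : {set {set 'I_N.+1}}) :
  2 * a.+2 <= N -> 'C(N, a.+1) + 2 <= 2 * 'C(N - a.+2, a.+1) ->
  6 * 'C(N, a) <= 'C(N, a.+1) ->
  F \subset ksets setT a.+2 -> G \subset ksets setT a.+2 -> meets F G ->
  (forall x, ~~ centered x (F :|: G)) ->
  2 * #|F| <= 'C(N, a.+1) \/ 2 * #|G| <= 'C(N, a.+1).
Proof.
move=> hN num1 num2; pose w (i : 'I_N.+1) : nat := i.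
move: {2}_.+1 (ltnSn (weight w F + weight w G)) => M.
elim: M F G => // M IH F G leM sF sG h nc.
have centeredU x (H K : {set {set 'I_N.+1}}) :
    centered x (H :|: K) = centered x H && centered x K.
  apply/centeredP/andP => [c|[/centeredP cH /centeredP cK] A].
    by split; apply/centeredP => A hA; apply: c; rewrite inE hA ?orbT.
  by rewrite inE => /orP[/cH|/cK].
have [/existsP[x cF]|/existsPn nF] := boolP [exists x, centered x F].
  left; have := nc x; rewrite centeredU cF => cG.
  by have := centered_bound sF sG h cF cG; lia.
have [/existsP[x cG]|/existsPn nG] := boolP [exists x, centered x G].
  right; have := nc x; rewrite centeredU cG andbT => cF.
  by have := centered_bound sG sF (meets_sym h) cG cF; lia.
pose mv (i j : 'I_N.+1) (H : {set {set 'I_N.+1}}) := [exists A in H, movable i j H A].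
have [/existsP[i /existsP[j /andP[ij mij]]]|/existsPn nm] :=
    (* Shift while some member can move. When none can, both families are shifted and the walk
       argument applies at the first point. *)
    boolP [exists i : 'I_N.+1, [exists j : 'I_N.+1, (i < j) && (mv i j F || mv i j G)]]; last first.
  have shF : shifted F.
    move=> i j ij A hA jA iA; have := existsPn (nm i) j.
    rewrite ij /= negb_or => /andP[/exists_inPn/(_ A hA)].
    by rewrite /movable jA iA /= negbK.
  have [ld|ld] := shifted_leads shF h; first exact: leads_bound ld _ _.
  by have [] := leads_bound hN num1 num2 sG sF (meets_sym h) ld (nG ord0) (nF ord0); auto.
have wij : w i < w j by [].
have wlt : weight w (shift i j F) + weight w (shift i j G) < weight w F + weight w G.
  case/orP: mij => /exists_inP[A hA mA].
    by rewrite -addSn leq_add ?weight_shift // (weight_shift_lt wij hA mA).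
  by rewrite -addnS leq_add ?weight_shift // (weight_shift_lt wij hA mA).
have sF' : shift i j F \subset ksets setT a.+2 by apply: shift_ksets.
have sG' : shift i j G \subset ksets setT a.+2 by apply: shift_ksets.
have [/existsP[x]|/existsPn nc'] :=
  boolP [exists x, centered x (shift i j F :|: shift i j G)]; last first.
  rewrite -(card_shift i j F) -(card_shift i j G).
  by apply: IH => //; [apply: leq_trans wlt _ | apply: meets_shift].
rewrite centeredU => /andP[/centeredP cF /centeredP cG].
(* Some member of [F] misses [x], and the only point a shift can add to it is [i]. *)
have xi : x = i.
  have [A hA xA] := centeredPn _ _ (nF x).
  have := cF _ (imset_f _ hA); rewrite /shift_set; case: ifP; last by rewrite (negPf xA).
  by rewrite !inE (negPf xA) andbF orbF => _ /eqP.
subst x.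
(* A moved set contained [j]; an unmoved one contains the centre [i]. *)
have pair A : A \in F :|: G -> (i \in A) || (j \in A).
  rewrite inE => /orP[hA|hA]; [have := cF _ (imset_f _ hA) | have := cG _ (imset_f _ hA)];
  by rewrite /shift_set; case: ifP => [/and3P[-> _ _]|_ ->]; rewrite ?orbT.
have nij : i != j by apply: contraTneq ij => ->; rewrite ltnn.
have := two_point_bound hN nij sF sG h pair (nF i) (nG i) (nF j) (nG j).
have [le1|lt1] := leqP (2 * #|F|) 'C(N, a.+1); first by left.
by move=> le2; right; lia.
Qed.

(** * Estimates on binomial coefficients *)

Lemma INR_muln m n : INR (m * n) = Rmult (INR m) (INR n).
Proof. exact: mult_INR. Qed.

Lemma INR_addn m n : INR (m + n) = Rplus (INR m) (INR n).
Proof. exact: plus_INR. Qed.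

Lemma INR_expn m n : INR (m ^ n) = pow (INR m) n.
Proof. by elim: n => [//|n IH]; rewrite expnS INR_muln IH. Qed.

Lemma INR_leq m n : m <= n <-> Rle (INR m) (INR n).
Proof. by split=> [/leP/le_INR|/INR_le/leP]. Qed.

(** The quotient of the binomials is a product of [r] factors [(M + k - i) / (M - i)]; as [M - i] is
    at least [d], each is at most [(d + k) / d]. *)
Lemma bin_ratio_upper M k d r : r + d <= M.+1 ->
  'C(M + k, r) * d ^ r <= 'C(M, r) * (d + k) ^ r.
Proof.
elim: r => [|r IH] le_rd; first by rewrite !bin0.
have {}IH := IH (leq_trans (leqnSn _) le_rd).
rewrite -(leq_pmul2l (ltn0Sn r)) !mulnA !mul_bin_left !expnS.
have step : (M + k - r) * d <= (M - r) * (d + k).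
  have : d <= M - r by lia.
  by rewrite -addnBAC ?mulnDl ?mulnDr; [nia | lia].
have := leq_mul step IH; nia.
Qed.

Lemma bin_ratio_lower M s r :
  'C(M, r) * (M + s) ^ r <= 'C(M + s, r) * M ^ r.
Proof.
elim: r => [|r IH]; first by rewrite !bin0.
rewrite -(leq_pmul2l (ltn0Sn r)) !mulnA !mul_bin_left !expnS.
have step : (M - r) * (M + s) <= (M + s - r) * M.
  have [le_rM|/ltnW] := leqP r M; last by rewrite -subn_eq0 => /eqP ->.
  rewrite -addnBAC // mulnDl mulnDr leq_add2l mulnC; nia.
have := leq_mul step IH; nia.
Qed.

Lemma pow_le_exp x r : Rle (-1) x -> Rle (pow (1 + x) r) (exp (INR r * x)).
Proof.
move=> hx; have -> : exp (INR r * x) = pow (exp x) r.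
  elim: r => [|r IH]; first by rewrite Rmult_0_l exp_0.
  by rewrite S_INR Rmult_plus_distr_r Rmult_1_l exp_plus IH /= Rmult_comm.
apply: pow_incr; split; first by lra.
have [->|nx] := Req_dec x 0; first by rewrite exp_0; lra.
by have := exp_ineq1 x nx; lra.
Qed.

(** The square of [exp (3 / 7)] exceeds [100 / 49], which is above 2. *)
Lemma ln2_lt : (ln 2 < 6 / 7)%Re.
Proof.
rewrite -(ln_exp (6 / 7)); apply: ln_increasing; first by lra.
have -> : (6 / 7 = 3 / 7 + 3 / 7)%Re by lra.
rewrite exp_plus; have := exp_ineq1 (3 / 7) ltac:(lra); nra.
Qed.

Lemma log2e_mul_ln2 : (c_log2e * ln 2 = 1)%Re.
Proof. by apply: Rinv_l; have := ln_lt_2; lra. Qed.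

Lemma log2e_gt : (7 / 6 < c_log2e)%Re.
Proof. have := log2e_mul_ln2; have := ln2_lt; have := ln_lt_2; nra. Qed.

(** The linear bound is exactly what [bin_six] requires. It follows from [c_log2e > 7 / 6], since
    the hypothesis reads [n >= c k (k - 1) + 2 k]. *)
Lemma large_n_linear n k : 2 <= k ->
  Rge (INR n) (Rplus (Rmult c_log2e (pow (INR k) 2)) (Rmult (Rminus (IZR 2) c_log2e) (INR k))) ->
  7 * k <= n + 7.
Proof.
move=> hk hn.
have : 7 * k * k + 5 * k < 6 * n.
  apply/ltP/INR_lt; rewrite INR_addn !INR_muln.
  have k2 : (2 <= INR k)%Re by apply: (proj1 (INR_leq 2 k)).
  have : (0 < (c_log2e - 7 / 6) * (INR k * (INR k - 1)))%Re.
    by have := log2e_gt => hc; apply: Rmult_lt_0_compat; [lra | nra].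
  have -> : INR 7 = 7%Re by rewrite /=; lra.
  have -> : INR 6 = 6%Re by rewrite /=; lra.
  have -> : INR 5 = 5%Re by rewrite /=; lra.
  by rewrite /pow Rmult_1_r in hn; lra.
have [k4|k4] := leqP 4 k; last by case: k hk k4 {hn} => [|[|[|[|]]]] //; lia.
have : 6 * k <= k * k + 8 by nia.
by lia.
Qed.

Lemma large_n_bin N a :
  Rge (INR N.+1) (Rplus (Rmult c_log2e (pow (INR a.+2) 2)) (Rmult (Rminus (IZR 2) c_log2e) (INR a.+2))) ->
  'C(N, a.+1) + 2 <= 2 * 'C(N - a.+2, a.+1).
Proof.
move=> hn; have lin := @large_n_linear N.+1 a.+2 isT hn.
case: a => [|a] in hn lin *; first by rewrite !bin1; lia.
pose d := N - 2 * a.+2; pose M := N - a.+3.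
have NM : N = M + a.+3 by rewrite /M; lia.
have Md : M = d + a.+1 by rewrite /M /d; lia.
have d7 : 7 <= d by rewrite /d; lia.
(* The ratio bound [4 d / (2 d + 1)] proved next falls short of 2 by [2 / (2 d + 1)]. With this
   lower bound on ['C(M, a.+2)], the gap yields the additive 2 of the conclusion. *)
have C'ge : 2 * d + 1 <= 'C(M, a.+2).
  have : 'C(d.-1 + 2, d.-1) <= 'C(M, a.+2).
    rewrite (_ : a.+2 = M - d.-1) ?bin_sub; try lia.
    by apply: leq_bin2l; lia.
  have -> : 'C(d.-1 + 2, d.-1) = 'C(d.+1, 2).
    by rewrite -bin_sub; [congr 'C(_, _); lia | lia].
  apply: leq_trans; rewrite bin2 -leq_double /=; have : d <= d * d.+1 by nia.
  by have := odd_double_half (d.+1 * d); nia.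
have ineq : 'C(N, a.+2) * (2 * d + 1) <= 4 * d * 'C(M, a.+2).
  have := @bin_ratio_upper M a.+3 d a.+2 ltac:(lia); rewrite -NM.
  move=> /INR_leq; rewrite 2!INR_muln 2!INR_expn INR_addn => hr.
  apply/INR_leq; rewrite !INR_muln INR_addn !INR_muln.
  have dpos : (0 < INR d)%Re by apply: lt_0_INR; lia.
  have Cpos : (0 <= INR 'C(M, a.+2))%Re by apply: pos_INR.
  have step1 : (INR 'C(N, a.+2) <= INR 'C(M, a.+2) * (1 + INR a.+3 / INR d) ^ a.+2)%Re.
    apply: (Rmult_le_reg_r (INR d ^ a.+2)); first exact: pow_lt.
    rewrite Rmult_assoc -Rpow_mult_distr.
    by have -> : ((1 + INR a.+3 / INR d) * INR d = INR d + INR a.+3)%Re by field; lra.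
  have step2 : ((1 + INR a.+3 / INR d) ^ a.+2 <= exp (ln 2 - ln 2 / INR d))%Re.
    apply: Rle_trans (pow_le_exp _ _) _.
      have : (0 <= INR a.+3 / INR d)%Re; last by lra.
      by apply: Rmult_le_pos; [apply: pos_INR | left; apply: Rinv_0_lt_compat].
    (* With [k = a.+3], [d] equals [n - 2 k + 1], so the hypothesis on [n] becomes
       [c k (k - 1) <= d - 1]; multiply by [ln 2]. *)
    have expo : (INR a.+2 * (INR a.+3 / INR d) <= ln 2 - ln 2 / INR d)%Re.
      apply: (Rmult_le_reg_r (INR d)) => //.
      have -> : (INR a.+2 * (INR a.+3 / INR d) * INR d = INR a.+2 * INR a.+3)%Re.
        by field; lra.
      have -> : ((ln 2 - ln 2 / INR d) * INR d = ln 2 * (INR d - 1))%Re.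
        by field; lra.
      have Nd : INR N.+1 = (INR d + 2 * INR a.+3 - 1)%Re.
        have -> : N.+1 = d + a.+2 + a.+3 by rewrite /d; lia.
        by rewrite !INR_addn (S_INR a.+2); lra.
      move: hn; rewrite Nd (S_INR a.+2) /pow Rmult_1_r => hn.
      have ge0 : (0 <= INR d - 1 - c_log2e * (INR a.+2 * (INR a.+2 + 1)))%Re by lra.
      have := log2e_mul_ln2; have := ln_lt_2 => l2 cl.
      have := Rmult_le_pos (ln 2) _ ltac:(lra) ge0.
      have -> : (ln 2 * (INR d - 1 - c_log2e * (INR a.+2 * (INR a.+2 + 1)))
        = ln 2 * (INR d - 1) - (c_log2e * ln 2) * (INR a.+2 * (INR a.+2 + 1)))%Re.
        by ring.
      by rewrite cl; lra.
    by case: expo => [/exp_increasing/Rlt_le|->] //; apply: Rle_refl.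
  (* Since [exp v > 1 + v] and [ln 2 > 1 / 2], [2 d exp v] exceeds [2 d + 1]; this is where
     [2 d + 1] comes from. *)
  have step3 : (exp (ln 2 - ln 2 / INR d) * (2 * INR d + 1) <= 4 * INR d)%Re.
    set E := exp _; pose v := (ln 2 / INR d)%Re.
    have Epos : (0 < E)%Re by apply: exp_pos.
    have EV : (E * exp v = 2)%Re.
      rewrite /E -exp_plus (_ : _ + _ = ln 2)%Re ?exp_ln; rewrite /v; lra.
    have vd : (v * INR d = ln 2)%Re by rewrite /v; field; lra.
    have l2 := ln_lt_2.
    have v0 : (0 < v)%Re.
      by apply: (Rmult_lt_reg_r (INR d)) => //; rewrite Rmult_0_l vd; lra.
    have ev : (1 + v < exp v)%Re by apply: exp_ineq1; lra.
    have : ((2 * INR d + 1) <= 2 * INR d * exp v)%Re.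
      have := Rmult_lt_compat_l (INR d) _ _ dpos ev; lra.
    move=> /(Rmult_le_compat_l E _ _ (Rlt_le _ _ Epos)).
    have -> : (E * (2 * INR d * exp v) = 2 * INR d * (E * exp v))%Re by ring.
    by rewrite EV; lra.
  have -> : INR 4 = 4%Re by rewrite /=; lra.
  have -> : INR 2 = 2%Re by rewrite /=; lra.
  have -> : INR 1 = 1%Re by [].
  have le_CE := Rle_trans _ _ _ step1 (Rmult_le_compat_l _ _ _ Cpos step2).
  have d1 : (0 <= 2 * INR d + 1)%Re by lra.
  have := Rmult_le_compat_r _ _ _ d1 le_CE.
  have := Rmult_le_compat_l _ _ _ Cpos step3; lra.
rewrite -/M -(@leq_pmul2r (2 * d + 1)) ?addn1 //.
move: C'ge ineq; set p := 'C(M, _); set q := 'C(N, _); clear; nia.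
Qed.

Lemma bin_six n k : 2 <= k -> 7 * k <= n + 7 ->
  6 * 'C(n.-1, k - 2) <= 'C(n.-1, k.-1).
Proof.
case: k => [|[|a]] // _ lin; rewrite subn2 /=.
rewrite -(leq_pmul2l (ltn0Sn a)) mul_bin_left mulnA leq_mul2r; lia.
Qed.

(** With [r = a.+1], the ratio of the binomials is at most [(1 - r / N) ^ r], hence at most
    [exp (- r ^ 2 / N)]. The hypothesis reads [N <= c (r ^ 2 - 1)], which puts this strictly below
    one half. *)
Lemma small_n_bin N a : a.+2 <= N ->
  Rle (INR N.+1) (Rplus (Rminus (Rmult c_log2e (pow (INR a.+2) 2))
    (Rmult (Rmult (IZR 2) c_log2e) (INR a.+2))) (IZR 1)) ->
  2 * 'C(N - a.+1, a.+1) < 'C(N, a.+1).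
Proof.
move=> aN hn; pose M := N - a.+1; have NM : N = M + a.+1 by rewrite /M; lia.
have Npos : (0 < INR N)%Re by apply: lt_0_INR; lia.
have := bin_ratio_lower M a.+1 a.+1; rewrite -NM => /INR_leq.
rewrite 2!INR_muln 2!INR_expn => hr.
have MN : INR M = (INR N - INR a.+1)%Re by rewrite [in INR N]NM INR_addn; lra.
have Cpos : (0 < INR 'C(N, a.+1))%Re.
  by apply: lt_0_INR; apply/ltP; rewrite bin_gt0; lia.
have step1 : (INR 'C(M, a.+1) <= INR 'C(N, a.+1) * (1 + - (INR a.+1 / INR N)) ^ a.+1)%Re.
  apply: (Rmult_le_reg_r (INR N ^ a.+1)); first exact: pow_lt.
  rewrite Rmult_assoc -Rpow_mult_distr.
  by have -> : ((1 + - (INR a.+1 / INR N)) * INR N = INR M)%Re by rewrite MN; field; lra.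
have step2 : ((1 + - (INR a.+1 / INR N)) ^ a.+1 < / 2)%Re.
  apply: Rle_lt_trans (pow_le_exp _ _) _.
    apply: (Rmult_le_reg_r (INR N)) => //.
    have -> : (- (INR a.+1 / INR N) * INR N = - INR a.+1)%Re by field; lra.
    by have := pos_INR M; rewrite MN; lra.
  rewrite -(exp_ln (/ 2)); last by lra.
  apply: exp_increasing; rewrite ln_Rinv; last by lra.
  apply: (Rmult_lt_reg_r (INR N)) => //.
  have -> : (INR a.+1 * - (INR a.+1 / INR N) * INR N = - (INR a.+1 * INR a.+1))%Re.
    by field; lra.
  move: hn; rewrite (S_INR N) (S_INR a.+1) /pow Rmult_1_r => hn.
  have ge0 : (0 <= c_log2e * (INR a.+1 * INR a.+1 - 1) - INR N)%Re by lra.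
  have := log2e_mul_ln2; have := ln_lt_2 => l2 cl.
  have := Rmult_le_pos (ln 2) _ ltac:(lra) ge0.
  have -> : (ln 2 * (c_log2e * (INR a.+1 * INR a.+1 - 1) - INR N)
    = (c_log2e * ln 2) * (INR a.+1 * INR a.+1 - 1) - ln 2 * INR N)%Re by ring.
  by rewrite cl; lra.
apply/ltP/INR_lt; rewrite INR_muln (_ : INR 2 = 2%Re); last by rewrite /=; lra.
have := Rmult_lt_compat_l _ _ _ Cpos step2; rewrite -/M; lra.
Qed.

(** * Bounds on [fAB] *)

Lemma good_pairP n k (F G : {set {set 'I_n}}) :
  reflect [/\ F \subset ksets setT k, G \subset ksets setT k, [disjoint F & G] &
              meets F G] (good_pair k (F, G)).
Proof.
have uniP (H : {set {set 'I_n}}) : k_uniform k H = (H \subset ksets setT k).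
  apply/forall_inP/subsetP => h A /h; first by rewrite inE subsetT.
  by rewrite inE => /andP[].
rewrite /good_pair !uniP; apply: (iffP and4P) => -[-> -> -> h]; split=> //.
  move=> A B hA hB; have /set0Pn[x] := forall_inP (forall_inP h A hA) B hB.
  by rewrite inE => /andP[]; exists x.
apply/forall_inP => A hA; apply/forall_inP => B hB; have [x xA xB] := h A B hA hB.
by apply/set0Pn; exists x; rewrite inE xA.
Qed.

Lemma fAB_geq n k m (F G : {set {set 'I_n}}) :
  good_pair k (F, G) -> m <= #|F| -> m <= #|G| -> m <= fAB n k.
Proof.
move=> gFG mF mG; apply: leq_trans (leq_bigmax_cond _ gFG).
by rewrite leq_min mF.
Qed.

Lemma exists_subset_card (T : finType) (A : {set T}) m :
  m <= #|A| -> exists2 B : {set T}, B \subset A & #|B| = m.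
Proof.
rewrite -bin_gt0 -card_ksets => /card_gt0P[B]; rewrite inE => /andP[sB /eqP cB].
by exists B.
Qed.

Definition star N a (x : 'I_N.+1) : {set {set 'I_N.+1}} :=
  [set A in ksets setT a.+1 | x \in A].

Lemma card_full_star N a (x : 'I_N.+1) : #|star a x| = 'C(N, a).
Proof. by rewrite card_star ?inE // cardsT card_ord. Qed.

Lemma fAB_geq_half N a : 'C(N, a) %/ 2 <= fAB N.+1 a.+1.
Proof.
pose X := star a (ord0 : 'I_N.+1).
have [F sF cF] : exists2 F : {set {set 'I_N.+1}}, F \subset X & #|F| = 'C(N, a) %/ 2.
  by apply: exists_subset_card; rewrite card_full_star leq_div.
have sX : X \subset ksets setT a.+1 by apply/subsetP => A; rewrite inE => /andP[].
apply: (@fAB_geq _ _ _ F (X :\: F)); last 1 first.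
- by rewrite cardsD (setIidPr sF) cF card_full_star; lia.
- apply/good_pairP; split.
  + exact: subset_trans sF sX.
  + exact: subset_trans (subsetDl _ _) sX.
  + by rewrite disjoint_sym disjoints_subset; apply/subsetP => A; rewrite !inE => /andP[].
  + move=> A B /(subsetP sF); rewrite !inE => /andP[_ xA] /and3P[_ _ xB].
    by exists ord0.
- by rewrite cF.
Qed.

Lemma common_center_bound N a (x : 'I_N.+1) (F G : {set {set 'I_N.+1}}) :
  F \subset ksets setT a.+1 -> G \subset ksets setT a.+1 -> [disjoint F & G] ->
  centered x (F :|: G) -> #|F| + #|G| <= 'C(N, a).
Proof.
move=> sF sG dFG /centeredP c.
have := (leq_card_setU F G).2; rewrite dFG => /eqP <-.
rewrite -(card_full_star a x); apply: subset_leq_card; apply/subsetP => A hA.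
rewrite inE c // andbT; move: hA; rewrite in_setU.
by case/orP; apply/subsetP.
Qed.

Lemma fAB_large N a :
  2 * a.+2 <= N -> 'C(N, a.+1) + 2 <= 2 * 'C(N - a.+2, a.+1) ->
  6 * 'C(N, a) <= 'C(N, a.+1) -> fAB N.+1 a.+2 = 'C(N, a.+1) %/ 2.
Proof.
move=> hN num1 num2; apply/eqP; rewrite eqn_leq fAB_geq_half andbT.
apply/bigmax_leqP => -[F G] /good_pairP[sF sG dFG h] /=; rewrite leq_divRL //.
have [/existsP[x c]|/existsPn nc] := boolP [exists x, centered x (F :|: G)].
  apply: leq_trans (common_center_bound sF sG dFG c).
  by rewrite muln2 -addnn leq_add ?geq_minl ?geq_minr.
rewrite mulnC; have [] := no_common_center_bound hN num1 num2 sF sG h nc;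
  by apply: leq_trans; rewrite leq_mul2l ?geq_minl ?geq_minr.
Qed.

Lemma fAB_small N a :
  a.+4 <= N -> 2 * 'C(N - a.+1, a.+1) < 'C(N, a.+1) ->
  'C(N, a.+1) %/ 2 < fAB N.+1 a.+2.
Proof.
move=> hN num; pose x : 'I_N.+1 := ord0; pose X := star a.+1 x.
have sX : X \subset ksets setT a.+2 by apply/subsetP => A; rewrite inE => /andP[].
have [U sU cU] : exists2 U : {set 'I_N.+1}, U \subset setT :\ x & #|U| = a.+1.
  by apply: exists_subset_card; rewrite card_setTD1; lia.
have xU : x \notin U by have := subsetP sU x; rewrite !inE eqxx; case: (x \in U) => // /(_ isT).
(* The members of the star that meet [U]; those avoiding [U] number ['C(N - a.+1, a.+1)], less than
   half of the star. *)
pose Y := X :\: ksets (~: U) a.+2.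
have cY : 'C(N, a.+1) %/ 2 < #|Y|.
  have -> : #|Y| = 'C(N, a.+1) - 'C(N - a.+1, a.+1); last by lia.
  rewrite cardsD card_full_star; congr (_ - _).
  have -> : X :&: ksets (~: U) a.+2 = [set A in ksets (~: U) a.+2 | x \in A].
    by apply/setP => A; rewrite !inE subsetT /=; case: (#|A| == _); case: (x \in A); rewrite ?andbF ?andbT.
  by rewrite card_star ?inE // cardsCs setCK card_ord cU; congr 'C(_, _); lia.
have [F sF cF] : exists2 F : {set {set 'I_N.+1}}, F \subset Y & #|F| = ('C(N, a.+1) %/ 2).+1.
  exact: exists_subset_card.
have /card_gt1P[y [z [yR zR yz]]] : 1 < #|~: (x |: U)|.
  by rewrite cardsCs setCK card_ord cardsU1 xU cU; lia.
move: yR zR; rewrite !inE !negb_or => /andP[yx yU] /andP[zx zU].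
(* Once [F] takes one more than half of the star, rounded down, the rest of the star can be two
   short of that size; these two sets make up for it. They meet every member of [F] because they
   contain [U]. *)
pose P := [set y |: U; z |: U].
have cP : #|P| = 2.
  rewrite cards2; case: eqVneq => // e.
  have : y \in z |: U by rewrite -e !inE eqxx.
  by rewrite !inE (negPf yz) (negPf yU).
have FX : F \subset X := subset_trans sF (subsetDl _ _).
have PX A : A \in P -> (x \notin A) /\ (U \subset A).
  by rewrite !inE => /orP[] /eqP ->; rewrite subsetUr !inE (eq_sym x) ?(negPf yx) ?(negPf zx) (negPf xU).
have dPX : [disjoint P & X].
  by apply/pred0P => A /=; apply/negP => /andP[/PX[xA _]]; rewrite inE (negPf xA) andbF.
apply: (@fAB_geq _ _ _ F ((X :\: F) :|: P)).
- apply/good_pairP; split.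
  + exact: subset_trans FX sX.
  + rewrite subUset (subset_trans (subsetDl _ _) sX) /=; apply/subsetP => A.
    by rewrite !inE subsetT => /orP[] /eqP ->; rewrite cardsU1 cU ?yU ?zU add1n /=.
  + apply/pred0P => A /=; apply/negP => /andP[hA]; rewrite inE in_setD hA /= => hP.
    by have := pred0P dPX A; rewrite /= hP (subsetP FX).
  + move=> A B hA; rewrite inE => /orP[|/PX[_ UB]].
      rewrite !inE => /and3P[_ _ xB]; exists x => //.
      by have := subsetP FX A hA; rewrite inE => /andP[].
    have := subsetP sF A hA; rewrite !inE => /andP[nU /andP[/andP[_ cA] xA]].
    move: nU; rewrite cA andbT => /subsetPn[w wA]; rewrite inE negbK => wU.
    by exists w => //; apply: (subsetP UB).
- by rewrite cF.
have := (leq_card_setU (X :\: F) P).2.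
rewrite (_ : [disjoint _ & _] = true); last first.
  rewrite disjoint_sym; apply: disjointWr dPX; exact: subsetDl.
by move=> /eqP ->; rewrite cardsD (setIidPr FX) cF cP card_full_star; lia.
Qed.

(* Real arithmetic written with explicit Stdlib operators to avoid scope clashes. *)
Theorem theorem1p4 (n k : nat) (hk : 2 <= k) (hn : 2 * k < n) :
  (Rge (INR n) (Rplus (Rmult c_log2e (pow (INR k) 2)) (Rmult (Rminus (IZR 2) c_log2e) (INR k))) ->
     fAB n k = 'C(n.-1, k.-1) %/ 2) /\
  (Rle (INR n) (Rplus (Rminus (Rmult c_log2e (pow (INR k) 2)) (Rmult (Rmult (IZR 2) c_log2e) (INR k))) (IZR 1)) ->
     fAB n k <> 'C(n.-1, k.-1) %/ 2).
Proof.
case: k hk hn => [|[|a]] // hk; case: n => [|N] // hn; split=> hR.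
  apply: fAB_large => //; first exact: large_n_bin.
  by have := bin_six hk (large_n_linear hk hR); rewrite subn2.
have hN : a.+4 <= N by lia.
have := fAB_small hN (small_n_bin (ltnW (ltnW hN)) hR) => lt e.
by rewrite e ltnn in lt.
Qed.
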